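(* Let $K$ be a field of characteristic $2$, let $q = 2^{\alpha}$ with $\alpha$ a positive integer, and let $n$ be an integer with $q/2 < n \leq q$. Then $$\wedge^2(W_n) \cong \wedge^2(W_{q-n}) \oplus W_{q-1}^{n-q/2}$$ as $\mathfrak{w}_q$-modules.
   Context: $\mathfrak{w}_q$ is the abelian $2$-Lie algebra (restricted Lie algebra) over $K$ generated by a single nilpotent element $e$ with $e^{[q]} = 0$, so $\mathfrak{w}_q = \bigoplus_{0 \leq i < \alpha} \langle e^{[2^i]} \rangle$ as a vector space. In a restricted module $e^{[2^i]}$ acts as the $2^i$-th power of the action of $e$, so a restricted $\mathfrak{w}_q$-module is the same as a $K$-vector space with an endomorphism $e$ such that $e^q = 0$. The indecomposable restricted $\mathfrak{w}_q$-modules are $W_1, \ldots, W_q$, where $\dim W_i = i$ and $e$ acts on $W_i$ as a single $i \times i$ nilpotent Jordan block. Set $W_0 = 0$. For a module $W$, $W^0 = 0$ and $W^d$ is the direct sum of $d$ copies of $W$ for $d>0$. The exterior square carries the Lie algebra action $e \cdot (v \wedge w) = ev \wedge w + v \wedge ew$. *)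

(* Defs.v *)
From HB Require Import structures.
From mathcomp Require Import all_boot all_order all_algebra.
From mathcomp Require Import boolp finmap monalg.

Set Implicit Arguments.
Unset Strict Implicit.
Unset Printing Implicit Defensive.

Import GRing.Theory.
Local Open Scope ring_scope.
Local Open Scope quotient_scope.

Section ExteriorSquare.
Variables (K : fieldType) (V : lmodType K).

Local Notation free := {malg K[(V * V)%type]}.
Local Notation pure v w := (mkmalgU ((v, w) : (V * V)%type) (1 : K)).

(* [{malg K[V * V]}] is only used as the vector space of finitely supported
   functions, i.e. the free vector space on [V * V] with basis [pure v w].
   [ext_null] is its subspace spanned by the relations making
   [(v, w) |-> v /\ w] bilinear and alternating. *)
Inductive ext_null : free -> Prop :=
| ext_null0 : ext_null 0
| ext_nullP a g h : ext_null g -> ext_null h -> ext_null (a *: g + h)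
| ext_null_alt v : ext_null (pure v v)
| ext_null_l a u v w :
    ext_null (pure (a *: u + v) w - (a *: pure u w + pure v w))
| ext_null_r a u v w :
    ext_null (pure u (a *: v + w) - (a *: pure u v + pure u w)).

Definition ext_nullb : {pred free} := fun g => `[< ext_null g >].

Lemma ext_nullb_zmod_closed : zmod_closed ext_nullb.
Proof.
split=> [|g h /asboolP Ng /asboolP Nh]; apply/asboolP; first exact: ext_null0.
by rewrite addrC -scaleN1r; apply: ext_nullP.
Qed.

HB.instance Definition _ :=
  GRing.isZmodClosed.Build free ext_nullb ext_nullb_zmod_closed.

Definition ext2 : Type := Quotient.quot (ext_nullb : zmodClosed free).

HB.instance Definition _ := GRing.Zmodule.on ext2.

Definition ext_pi (g : free) : ext2 := \pi_(Quotient.quot (ext_nullb : zmodClosed free)) g.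

Lemma ext_piP g h : ext_pi g = ext_pi h <-> ext_null (g - h).
Proof.
rewrite /ext_pi; split=> [/eqP|N].
  by rewrite -Quotient.idealrBE => /asboolP.
by apply/eqP; rewrite -Quotient.idealrBE; apply/asboolP.
Qed.

Lemma ext_piD : {morph ext_pi : g h / g + h}.
Proof. by move=> g h; rewrite /ext_pi raddfD. Qed.

Lemma ext_pi0 : ext_pi 0 = 0.
Proof. exact: raddf0. Qed.

Lemma ext_reprK (x : ext2) : ext_pi (repr x) = x.
Proof. exact: reprK. Qed.

(* [locked] only keeps unification from unfolding the quotient. *)
Definition ext_scale : K -> ext2 -> ext2 :=
  locked (fun a x => ext_pi (a *: repr x)).

Lemma ext_pi_scale a g : ext_scale a (ext_pi g) = ext_pi (a *: g).
Proof.
rewrite /ext_scale -lock; apply/ext_piP.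
rewrite -scalerBr -[_ *: _]addr0; apply: ext_nullP.
  by apply/ext_piP; rewrite ext_reprK.
exact: ext_null0.
Qed.

Fact ext_scaleA a b x : ext_scale a (ext_scale b x) = ext_scale (a * b) x.
Proof. by rewrite -(ext_reprK x) !ext_pi_scale scalerA. Qed.
Fact ext_scale1 : left_id 1 ext_scale.
Proof. by move=> x; rewrite -(ext_reprK x) ext_pi_scale scale1r. Qed.
Fact ext_scaleDr : right_distributive ext_scale +%R.
Proof.
move=> a x y; rewrite -(ext_reprK x) -(ext_reprK y) -ext_piD !ext_pi_scale.
by rewrite scalerDr ext_piD.
Qed.
Fact ext_scaleDl x : {morph ext_scale^~ x : a b / a + b}.
Proof. by move=> a b; rewrite -(ext_reprK x) !ext_pi_scale scalerDl ext_piD. Qed.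

HB.instance Definition _ := GRing.Zmodule_isLmodule.Build K ext2
  ext_scaleA ext_scale1 ext_scaleDr ext_scaleDl.

Lemma ext_piZ a g : ext_pi (a *: g) = a *: ext_pi g.
Proof. by rewrite -ext_pi_scale. Qed.

Definition wedge : V -> V -> ext2 := locked (fun v w => ext_pi (pure v w)).

Lemma wedgeE v w : wedge v w = ext_pi (pure v w).
Proof. by rewrite /wedge -lock. Qed.

Lemma wedge_linearl w : linear (wedge^~ w).
Proof.
by move=> a u v; rewrite !wedgeE -ext_piZ -ext_piD; apply/ext_piP/ext_null_l.
Qed.

Lemma wedge_linearr v : linear (wedge v).
Proof.
by move=> a u w; rewrite !wedgeE -ext_piZ -ext_piD; apply/ext_piP/ext_null_r.
Qed.

Lemma wedgevv v : wedge v v = 0.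
Proof.
by rewrite wedgeE -ext_pi0; apply/ext_piP; rewrite subr0; apply: ext_null_alt.
Qed.

Lemma wedgeDl u v w : wedge (u + v) w = wedge u w + wedge v w.
Proof. by have := wedge_linearl w 1 u v; rewrite !scale1r. Qed.

Lemma wedgeDr u v w : wedge u (v + w) = wedge u v + wedge u w.
Proof. by have := wedge_linearr u 1 v w; rewrite !scale1r. Qed.

Lemma wedgeBl u v w : wedge (u - v) w = wedge u w - wedge v w.
Proof. by have := wedgeDl (u - v) v w; rewrite subrK => ->; rewrite addrK. Qed.

Lemma wedgeBr u v w : wedge u (v - w) = wedge u v - wedge u w.
Proof. by have := wedgeDr u (v - w) w; rewrite subrK => ->; rewrite addrK. Qed.

(* Universal property: see [ext_lift_wedge], [ext_lift_linear], [ext2_eq]. *)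
Section Lift.
Variables (U : lmodType K) (f : V -> V -> U).

Definition alternating_bilinear :=
  [/\ forall w, linear (f^~ w), forall v, linear (f v) & forall v, f v v = 0].

Definition free_lift (g : free) : U :=
  \sum_(k <- msupp g) mcoeff k g *: f k.1 k.2.

Lemma free_liftEw (d : {fset V * V}) g :
  (msupp g `<=` d)%fset -> free_lift g = \sum_(k <- d) mcoeff k g *: f k.1 k.2.
Proof.
move=> le; rewrite /free_lift (big_fset_incl _ le) // => k _ /mcoeff_outdom ->.
by rewrite scale0r.
Qed.

Lemma free_lift_linear : linear free_lift.
Proof.
move=> a g h; pose d := (msupp g `|` msupp h)%fset.
rewrite (@free_liftEw d (a *: g + h)) ?(@free_liftEw d g) ?(@free_liftEw d h);
  rewrite ?fsubsetUl ?fsubsetUr //.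
  rewrite scaler_sumr -big_split; apply: eq_bigr => k _ /=.
  by rewrite mcoeffD mcoeffZ scalerDl scalerA.
apply: fsubset_trans (msuppD_le _ _) _; apply: fsetSU; exact: msuppZ_le.
Qed.

HB.instance Definition _ :=
  GRing.isLinear.Build K free U _ free_lift free_lift_linear.

Lemma free_lift_pure v w : free_lift (pure v w) = f v w.
Proof.
rewrite (@free_liftEw [fset (v, w)]%fset) ?msuppU_le //.
by rewrite big_seq_fset1 mcoeffUU scale1r.
Qed.

Definition ext_lift : ext2 -> U := locked (fun x => free_lift (repr x)).

Hypothesis altf : alternating_bilinear.

Lemma free_lift_null g : ext_null g -> free_lift g = 0.
Proof.
case: altf => fl fr fvv; elim=> [|a h1 h2 _ E1 _ E2|v|a u v w|a u v w].
- exact: linear0.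
- by rewrite linearP /= E1 E2 scaler0 addr0.
- by rewrite free_lift_pure.
- by rewrite linearB linearP /= !free_lift_pure fl subrr.
- by rewrite linearB linearP /= !free_lift_pure fr subrr.
Qed.

Lemma ext_lift_pi g : ext_lift (ext_pi g) = free_lift g.
Proof.
rewrite /ext_lift -lock; apply/eqP; rewrite -subr_eq0 -linearB /=; apply/eqP/free_lift_null/ext_piP.
exact: ext_reprK.
Qed.

Lemma ext_lift_linear : linear ext_lift.
Proof.
move=> a x y; rewrite -(ext_reprK x) -(ext_reprK y) -ext_piZ -ext_piD.
by rewrite !ext_lift_pi linearP.
Qed.

Lemma ext_lift_wedge v w : ext_lift (wedge v w) = f v w.
Proof. by rewrite wedgeE ext_lift_pi free_lift_pure. Qed.

End Lift.

Lemma ext2_ind (P : ext2 -> Prop) :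
  P 0 -> (forall a v w x, P x -> P (a *: wedge v w + x)) -> forall x, P x.
Proof.
move=> P0 PS x; rewrite -(ext_reprK x) (monalgE (repr x)).
elim: (enum_fset _) => [|[v w] s IH].
  by rewrite big_nil ext_pi0.
rewrite big_cons ext_piD.
have -> : mkmalgU (v, w) (mcoeff (v, w) (repr x)) =
          mcoeff (v, w) (repr x) *: pure v w :> free.
  by apply/malgP => k; rewrite mcoeffZ !mcoeffU; case: eqP;
     rewrite ?mulr1n ?mulr1 ?mulr0n ?mulr0.
by rewrite ext_piZ -wedgeE; apply: PS.
Qed.

Lemma ext2_eq (U : lmodType K) (f g : {linear ext2 -> U}) :
  (forall v w, f (wedge v w) = g (wedge v w)) -> f =1 g.
Proof.
by move=> E; elim/ext2_ind => [|a v w x IH]; rewrite ?linear0 // !linearP E IH.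
Qed.

End ExteriorSquare.

(* 2-Lie algebras (restricted Lie algebras in characteristic 2); [pmap] is
   the 2-map [x |-> x^[2]]. *)
Record lie2 (K : fieldType) := Lie2 {
  lie2_sort :> lmodType K;
  bracket : lie2_sort -> lie2_sort -> lie2_sort;
  pmap : lie2_sort -> lie2_sort;
  lie2_char : 2%N \in [pchar K];
  bracket_linearl : forall y, linear (bracket^~ y);
  bracket_linearr : forall x, linear (bracket x);
  bracketxx : forall x, bracket x x = 0;
  bracket_jacobi : forall x y z,
    bracket x (bracket y z) + bracket y (bracket z x)
      + bracket z (bracket x y) = 0;
  pmapZ : forall a x, pmap (a *: x) = a ^+ 2 *: pmap x;
  pmapD : forall x y, pmap (x + y) = pmap x + pmap y + bracket x y;
  bracket_pmap : forall x y, bracket (pmap x) y = bracket x (bracket x y)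
}.

Record rmod (K : fieldType) (L : lie2 K) := RMod {
  rmod_sort :> lmodType K;
  act : L -> rmod_sort -> rmod_sort;
  act_linearl : forall v, linear (act^~ v);
  act_linearr : forall x, linear (act x);
  act_bracket : forall x y v,
    act (bracket x y) v = act x (act y v) - act y (act x v);
  act_pmap : forall x v, act (pmap x) v = act x (act x v)
}.

Definition rmod_iso (K : fieldType) (L : lie2 K) (M N : rmod L) : Prop :=
  exists f : {linear M -> N},
    bijective f /\ forall (x : L) (v : M), f (act x v) = act x (f v).

Section ModuleConstructions.
Variables (K : fieldType) (L : lie2 K).

Section DirectSum.
Variables M N : rmod L.

Definition dsum_act (x : L) (v : (M * N)%type) : (M * N)%type :=
  (act x v.1, act x v.2).

Fact dsum_act_linearl v : linear (dsum_act^~ v).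
Proof. by move=> a x y; rewrite /dsum_act !act_linearl. Qed.
Fact dsum_act_linearr x : linear (dsum_act x).
Proof. by move=> a v w; rewrite /dsum_act !act_linearr. Qed.
Fact dsum_act_bracket x y v : dsum_act (bracket x y) v =
  dsum_act x (dsum_act y v) - dsum_act y (dsum_act x v).
Proof. by rewrite /dsum_act !act_bracket. Qed.
Fact dsum_act_pmap x v : dsum_act (pmap x) v = dsum_act x (dsum_act x v).
Proof. by rewrite /dsum_act !act_pmap. Qed.

Definition dsum : rmod L :=
  RMod dsum_act_linearl dsum_act_linearr dsum_act_bracket dsum_act_pmap.
End DirectSum.

Section Copies.
Variables (d : nat) (M : rmod L).

Definition copies_act (x : L) (v : {ffun 'I_d -> M}) : {ffun 'I_d -> M} :=
  [ffun i => act x (v i)].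

Fact copies_act_linearl v : linear (copies_act^~ v).
Proof. by move=> a x y; apply/ffunP => i; rewrite !ffunE act_linearl. Qed.
Fact copies_act_linearr x : linear (copies_act x).
Proof. by move=> a v w; apply/ffunP => i; rewrite !ffunE act_linearr. Qed.
Fact copies_act_bracket x y v : copies_act (bracket x y) v =
  copies_act x (copies_act y v) - copies_act y (copies_act x v).
Proof. by apply/ffunP => i; rewrite !ffunE act_bracket. Qed.
Fact copies_act_pmap x v :
  copies_act (pmap x) v = copies_act x (copies_act x v).
Proof. by apply/ffunP => i; rewrite !ffunE act_pmap. Qed.

Definition copies : rmod L := RMod copies_act_linearl copies_act_linearr
  copies_act_bracket copies_act_pmap.
End Copies.

Section ExteriorSquareModule.
Variable M : rmod L.

Definition lie_wedge (x : L) (v w : M) : ext2 M :=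
  wedge (act x v) w + wedge v (act x w).

Fact lie_wedge_alt x : alternating_bilinear (lie_wedge x).
Proof.
split=> [w a u v|v a u w|v]; rewrite /lie_wedge.
- by rewrite act_linearr !wedge_linearl scalerDr addrACA.
- by rewrite act_linearr !wedge_linearr scalerDr addrACA.
have := wedgevv (act x v + v); rewrite wedgeDl !wedgeDr.
by rewrite !wedgevv add0r addr0.
Qed.

(* [x . (v /\ w) = x v /\ w + v /\ x w], see [ext2_act_wedge] *)
Definition ext2_act (x : L) (t : ext2 M) : ext2 M := ext_lift (lie_wedge x) t.

Lemma ext2_act_wedge x v w :
  ext2_act x (wedge v w) = wedge (act x v) w + wedge v (act x w).
Proof. exact: ext_lift_wedge (lie_wedge_alt x) v w. Qed.

Fact ext2_act_linearr x : linear (ext2_act x).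
Proof. exact: ext_lift_linear (lie_wedge_alt x). Qed.

Fact ext2_act0 x : ext2_act x 0 = 0.
Proof.
by have := ext2_act_linearr x (-1) 0 0; rewrite scaler0 addr0 scaleN1r addNr.
Qed.

Fact ext2_actD x t u : ext2_act x (t + u) = ext2_act x t + ext2_act x u.
Proof. by have := ext2_act_linearr x 1 t u; rewrite !scale1r. Qed.

Fact ext2_act_linearl t : linear (ext2_act^~ t).
Proof.
move=> a x y; elim/ext2_ind: t => [|b v w t IH].
  by rewrite !ext2_act0 scaler0 addr0.
rewrite !ext2_act_linearr IH !ext2_act_wedge !act_linearl.
rewrite wedge_linearl wedge_linearr (addrACA (a *: _)) -scalerDr.
by rewrite (scalerDr b) (scalerDr a (b *: _)) !scalerA (mulrC b) addrACA.
Qed.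

Fact ext2_act_bracket x y t : ext2_act (bracket x y) t =
  ext2_act x (ext2_act y t) - ext2_act y (ext2_act x t).
Proof.
elim/ext2_ind: t => [|b v w t IH]; first by rewrite !ext2_act0 subr0.
rewrite !ext2_act_linearr IH opprD addrACA -scalerBr; congr (_ *: _ + _).
rewrite !ext2_act_wedge !ext2_actD !ext2_act_wedge !act_bracket.
rewrite wedgeBl wedgeBr [X in _ = X - _]addrACA opprD [RHS]addrACA.
congr (_ + _).
  by rewrite opprD addrACA subrr addr0.
by rewrite opprD addrACA subrr add0r.
Qed.

Fact ext2_act_pmap x t : ext2_act (pmap x) t = ext2_act x (ext2_act x t).
Proof.
elim/ext2_ind: t => [|b v w t IH]; first by rewrite !ext2_act0.
rewrite !ext2_act_linearr IH; congr (_ *: _ + _).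
rewrite !ext2_act_wedge ext2_actD !ext2_act_wedge !act_pmap.
set u := wedge (act x v) (act x w).
have uu : u + u = 0.
  by rewrite -mulr2n -scaler_nat (pcharf0 (lie2_char L)) scale0r.
by rewrite -[RHS]addrA [X in _ = _ + X]addrA uu add0r.
Qed.

Definition ext2_mod : rmod L := RMod ext2_act_linearl ext2_act_linearr
  ext2_act_bracket ext2_act_pmap.

End ExteriorSquareModule.
End ModuleConstructions.

Section Wq.
Variable K : fieldType.
Hypothesis charK : 2%N \in [pchar K].

(* The nilpotent Jordan block, mapping the [i]-th basis row vector to the
   [i.+1]-st. *)
Definition jordan0 n : 'M[K]_n := \matrix_(i, j) (i.+1 == j :> nat)%:R.

Lemma jordan0X n m : jordan0 n ^+ m = \matrix_(i, j) (i + m == j :> nat)%N%:R.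
Proof.
elim: m => [|m IH].
  by apply/matrixP => i j; rewrite expr0 !mxE addn0.
apply/matrixP => i j; rewrite exprS IH !mxE.
have [lt|ge] := ltnP i.+1 n.
  rewrite (bigD1 (Ordinal lt)) //= !mxE eqxx mul1r addnS big1 ?addr0 // => k.
  by rewrite -val_eqE /= !mxE eq_sym => /negPf ->; rewrite mul0r.
rewrite big1 => [|k _].
  have /negPf -> // : (i + m.+1 != j)%N.
  by rewrite gtn_eqF // (leq_trans (ltn_ord j)) // (leq_trans ge) // addnS ltnS leq_addr.
by rewrite !mxE gtn_eqF ?mul0r // (leq_trans (ltn_ord k)).
Qed.

Lemma jordan0_nilp n m : (n <= m)%N -> jordan0 n ^+ m = 0.
Proof.
move=> le; apply/matrixP => i j; rewrite jordan0X !mxE gtn_eqF //.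
by rewrite (leq_trans (ltn_ord j)) // (leq_trans le) // leq_addl.
Qed.

Section LieAlgebra.
Variable alpha : nat.

(* The [i]-th basis vector of ['rV_alpha] is [e^[2^i]]. *)
Definition wq_pmap (x : 'rV[K]_alpha) : 'rV[K]_alpha :=
  map_mx (fun a => a ^+ 2) x *m jordan0 alpha.

Definition wq_bracket (x y : 'rV[K]_alpha) : 'rV[K]_alpha := 0.

Lemma charK_sqrD (a b : K) : (a + b) ^+ 2 = a ^+ 2 + b ^+ 2.
Proof. by rewrite sqrrD -mulr_natr (pcharf0 charK) mulr0 addr0. Qed.

Fact wq_bracket_linearl y : linear (wq_bracket^~ y).
Proof. by move=> a x z; rewrite /wq_bracket scaler0 addr0. Qed.
Fact wq_bracket_linearr x : linear (wq_bracket x).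
Proof. by move=> a y z; rewrite /wq_bracket scaler0 addr0. Qed.
Fact wq_bracketxx x : wq_bracket x x = 0.
Proof. by []. Qed.
Fact wq_jacobi x y z : wq_bracket x (wq_bracket y z)
  + wq_bracket y (wq_bracket z x) + wq_bracket z (wq_bracket x y) = 0.
Proof. by rewrite /wq_bracket !addr0. Qed.
Fact wq_pmapZ a x : wq_pmap (a *: x) = a ^+ 2 *: wq_pmap x.
Proof.
rewrite /wq_pmap scalemxAl; congr (_ *m _).
by apply/rowP => i; rewrite !mxE exprMn.
Qed.
Fact wq_pmapD x y : wq_pmap (x + y) = wq_pmap x + wq_pmap y + wq_bracket x y.
Proof.
rewrite /wq_pmap addr0 -mulmxDl; congr (_ *m _).
by apply/rowP => i; rewrite !mxE charK_sqrD.
Qed.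
Fact wq_bracket_pmap x y :
  wq_bracket (wq_pmap x) y = wq_bracket x (wq_bracket x y).
Proof. by []. Qed.

Definition wq : lie2 K := Lie2 charK wq_bracket_linearl wq_bracket_linearr
  wq_bracketxx wq_jacobi wq_pmapZ wq_pmapD wq_bracket_pmap.

Definition wq_e : wq := \row_(j < alpha) (j == 0 :> nat)%:R.

(* [e^[2^i]] is the [i]-th basis vector if [i < alpha], and [0] otherwise. *)
Lemma iter_pmap_wq_e i :
  iter i (@pmap K wq) wq_e = \row_(j < alpha) (j == i :> nat)%:R.
Proof.
elim: i => [//|i IH]; rewrite iterS IH /= /wq_pmap.
apply/rowP => j; rewrite !mxE.
have [lt|ge] := ltnP i alpha.
  rewrite (bigD1 (Ordinal lt)) //= !mxE eqxx expr1n mul1r big1 ?addr0.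
    by rewrite eq_sym.
  by move=> k; rewrite -val_eqE /= !mxE => /negPf ->; rewrite expr0n mul0r.
rewrite big1 => [|k _]; first by rewrite ltn_eqF // (leq_trans (ltn_ord j)) // leqW.
by rewrite !mxE ltn_eqF ?expr0n ?mul0r // (leq_trans (ltn_ord k)).
Qed.

Section IndecomposableModule.
Variable i : nat.

(* [e^[2^j]] acts as the [2^j]-th power of the Jordan block. *)
Definition W_mx (x : 'rV[K]_alpha) : 'M[K]_i :=
  \sum_(j < alpha) x 0 j *: jordan0 i ^+ (2 ^ j).

Definition W_act (x : wq) (v : 'rV[K]_i) : 'rV[K]_i := v *m W_mx x.

Hypothesis hi : (i <= 2 ^ alpha)%N.

Fact W_act_linearl v : linear (W_act^~ v).
Proof.
move=> a x y; rewrite /W_act scalemxAr -mulmxDr; congr (_ *m _).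
rewrite /W_mx scaler_sumr -big_split; apply: eq_bigr => j _ /=.
by rewrite !mxE scalerDl scalerA.
Qed.
Fact W_act_linearr x : linear (W_act x).
Proof. by move=> a v w; rewrite /W_act mulmxDl scalemxAl. Qed.

Lemma W_mx_comm x y : W_mx x *m W_mx y = W_mx y *m W_mx x.
Proof.
apply: comm_mx_sum => j _; apply/comm_mx_sym/comm_mx_sum => k _.
apply/comm_mx_sym; rewrite /comm_mx -!scalemxAl -!scalemxAr !scalerA mulrC.
by congr (_ *: _); apply: (commrX _ (commr_sym (commrX _ (commr_refl _)))).
Qed.

Fact W_act_bracket x y v :
  W_act (bracket x y) v = W_act x (W_act y v) - W_act y (W_act x v).
Proof.
rewrite /W_act -!mulmxA W_mx_comm subrr /W_mx big1 ?mulmx0 // => j _.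
by rewrite mxE scale0r.
Qed.

Lemma W_mx_pmap x : W_mx (wq_pmap x) = W_mx x *m W_mx x.
Proof.
transitivity (\sum_(k < alpha)
    (x 0 k *: jordan0 i ^+ (2 ^ k)) *m (x 0 k *: jordan0 i ^+ (2 ^ k))).
  rewrite /W_mx; under eq_bigr => j _ do rewrite mxE scaler_suml.
  rewrite exchange_big /=; apply: eq_bigr => k _.
  rewrite -scalemxAl -scalemxAr scalerA -[_ *m _]exprD addnn -mul2n -expnS.
  have [lt|ge] := ltnP k.+1 alpha.
    rewrite (bigD1 (Ordinal lt)) //= !mxE eqxx mulr1 big1 ?addr0 // => j.
    by rewrite -val_eqE /= eq_sym !mxE => /negPf ->; rewrite mulr0 scale0r.
  rewrite jordan0_nilp ?scaler0; last first.
    by rewrite (leq_trans hi) // leq_exp2l.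
  rewrite big1 // => j _.
  by rewrite !mxE gtn_eqF ?mulr0 ?scale0r // (leq_trans (ltn_ord j)).
pose y k := x 0 k *: jordan0 i ^+ (2 ^ k).
have yC k l : y k *m y l = y l *m y k.
  rewrite /y -!scalemxAl -!scalemxAr !scalerA mulrC.
  by congr (_ *: _); rewrite -[LHS]exprD -[RHS]exprD addnC.
rewrite /W_mx -/y; elim: (index_enum _) => [|k s IH].
  by rewrite !big_nil mulmx0.
rewrite !big_cons mulmxDl !mulmxDr IH -/(y k).
have -> : y k *m \sum_(j <- s) y j = (\sum_(j <- s) y j) *m y k.
  by rewrite mulmx_sumr mulmx_suml; apply: eq_bigr => j _.
rewrite -[RHS]addrA [X in _ = _ + X]addrA.
by rewrite -mulr2n -scaler_nat (pcharf0 charK) scale0r add0r.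
Qed.

Fact W_act_pmap x v : W_act (pmap x) v = W_act x (W_act x v).
Proof. by rewrite /W_act -mulmxA -W_mx_pmap. Qed.

Lemma W_mx_e : (0 < alpha)%N -> W_mx wq_e = jordan0 i.
Proof.
move=> alpha_gt0; rewrite /W_mx (bigD1 (Ordinal alpha_gt0)) //= !mxE scale1r.
rewrite big1 ?addr0 ?expr1 // => j.
by rewrite -val_eqE /= !mxE => /negPf ->; rewrite scale0r.
Qed.

Definition W : rmod wq :=
  RMod W_act_linearl W_act_linearr W_act_bracket W_act_pmap.

End IndecomposableModule.
End LieAlgebra.
End Wq.

Arguments W {K} charK {alpha i} hi.

(* Main.v *)
(* Put q = 2^alpha, p = q/2, d = n - p, m = q - n = p - d, let X_i be the
   basis of W_n (X_i = 0 for i >= n) and Y i j = X_i /\ X_j. Then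
   e (Y i j) = Y (i+1) j + Y i (j+1), so in characteristic 2
   e^(2^a) (Y i j) = Y (i+2^a) j + Y i (j+2^a), and the b_k = Y k (k+1)
   generate /\^2 W_n over K[e].
   - The rule b_k |-> 0 for k < d, b_(d+k) |-> X_k /\ X_(k+1) extends to a
     K[e]-map s : /\^2 W_n -> /\^2 W_m, because e^p vanishes on /\^2 W_m.
   - The b_k with k < d satisfy e^(q-1) b_k = Y k (k+q) = 0, while the
     coefficient of Y (k+p-1) (k+p) in e^(q-2) b_k = e^(p-1) (Y k (k+p)) is 1.
     These d coefficient functionals induce a K[e]-map
     r : /\^2 W_n -> W_(q-1)^d which, by degree reasons, is unitriangular on
     the submodule F generated by the b_k with k < d.
   - F and the span of the Y (i+d) (j+d) with i, j < m exhaust /\^2 W_n, since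
     Y (i+d) (j+p) = e^p (Y (i+d) j) lies in F.
   Hence (s, r) is bijective. *)
Require Import Defs.
From HB Require Import structures.
From mathcomp Require Import all_boot all_order all_algebra.
From mathcomp Require Import boolp zify.

Set Implicit Arguments.
Unset Strict Implicit.
Unset Printing Implicit Defensive.

Import GRing.Theory.
Local Open Scope ring_scope.

(** * Linearity of actions and of iterates *)

HB.instance Definition _ (K : fieldType) (L : lie2 K) (M : rmod L) (x : L) :=
  GRing.isLinear.Build K M M _ (@act K L M x) (@act_linearr K L M x).

Lemma iter_is_linear (K : fieldType) (U : lmodType K) (E : {linear U -> U}) a :
  linear (iter a E).
Proof. by elim: a => [|a IH] c u v; rewrite ?iterS -?linearP ?IH. Qed.

HB.instance Definition _ (K : fieldType) (U : lmodType K)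
    (E : {linear U -> U}) a :=
  GRing.isLinear.Build K U U _ (iter a E) (iter_is_linear E a).

Lemma addvv_char2 (K : fieldType) (charK : 2%N \in [pchar K])
    (U : lmodType K) (u : U) : u + u = 0.
Proof. by rewrite -mulr2n -scaler_nat (pcharf0 charK) scale0r. Qed.

(** * Arrays on which an endomorphism acts by the Leibniz rule *)

Section Ladder.
Variables (K : fieldType) (U : lmodType K).

(** Abstracts [X_i /\ X_j] under a derivation sending [X_i] to [X_(i+1)], with antisymmetry turned
    into symmetry by characteristic 2. *)
Definition ladder (E : U -> U) (Y : nat -> nat -> U) : Prop :=
  [/\ forall i, Y i i = 0, forall i j, Y i j = Y j i
    & forall i j, E (Y i j) = Y i.+1 j + Y i j.+1].

Hypothesis charK : 2%N \in [pchar K].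
Variable E : {linear U -> U}.

Lemma ladder_step Y i j : ladder E Y -> Y i j.+1 = E (Y i j) + Y i.+1 j.
Proof. by case=> _ _ ->; rewrite addrAC addvv_char2 ?add0r. Qed.

Lemma ladder_shift Y d : ladder E Y -> ladder E (fun i j => Y (i + d)%N (j + d)%N).
Proof. by case=> Y0 YC YE; split=> *; rewrite ?YE. Qed.

(** Induction on the distance between the indices, two consecutive distances at a time:
    [ladder_step] reaches distance [N + 2] from distances [N + 1] and [N]. *)
Lemma ladder_ind (P : U -> Prop) Y : ladder E Y ->
    P 0 -> (forall u v, P u -> P v -> P (u + v)) ->
    (forall u, P u -> P (E u)) -> (forall i, P (Y i i.+1)) ->
  forall i j, P (Y i j).
Proof.
move=> lY P0 PD PE Pb; have [Y0 YC _] := lY.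
suff PN N : (forall i, P (Y i (i + N)%N)) /\ (forall i, P (Y i (i + N.+1)%N)).
  move=> i j; case/orP: (leq_total i j) => le; last rewrite YC.
    by have [/(_ i)] := PN (j - i)%N; rewrite subnKC.
  by have [/(_ j)] := PN (i - j)%N; rewrite subnKC.
elim: N => [|N [IH1 IH2]]; split=> // i; rewrite ?addn0 ?Y0 ?addn1 //.
by rewrite addnS (ladder_step _ _ lY); apply: PD; [exact/PE | rewrite addnS -addSn].
Qed.

(** The difference of two ladders is a ladder, so [ladder_ind] applies to vanishing. *)
Lemma ladder_eq Y Z : ladder E Y -> ladder E Z ->
  (forall i, Y i i.+1 = Z i i.+1) -> forall i j, Y i j = Z i j.
Proof.
move=> lY lZ eqb i j; apply/eqP; rewrite -subr_eq0; apply/eqP.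
have [Y0 YC YE] := lY; have [Z0 ZC ZE] := lZ.
have lD : ladder E (fun i j => Y i j - Z i j).
  split=> [k|k l|k l]; first by rewrite Y0 Z0 subr0.
    by rewrite YC ZC.
  by rewrite linearB YE ZE opprD addrACA.
apply: (ladder_ind (P := fun u => u = 0) lD) => // [u v -> ->|u ->|k].
- by rewrite addr0.
- exact: linear0.
- by rewrite eqb subrr.
Qed.

(* [ladder_from b N i] is the entry in position [(i, i + N)]. *)
Fixpoint ladder_from (b : nat -> U) (N i : nat) : U :=
  if N is N'.+1 then
    if N' is N''.+1 then E (ladder_from b N' i) + ladder_from b N'' i.+1
    else b i
  else 0.

(** Solving the Leibniz rule for its outermost entry leaves the entries [b i] free; this is how
    [K[e]]-maps get prescribed on generators. *)
Lemma ladder_exists (b : nat -> U) :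
  exists2 Y, ladder E Y & forall i, Y i i.+1 = b i.
Proof.
pose h := ladder_from b.
exists (fun i j => h (maxn i j - minn i j)%N (minn i j)); last first.
  by move=> i; rewrite (maxn_idPr _) // (minn_idPl _) // subSnn.
split=> [i|i j|].
- by rewrite maxnn minnn subnn.
- by rewrite maxnC minnC.
(* For [N = 0] the entry at [(i.+1, i)] lies below the diagonal, whence the [maxn] and [minn]; both
   terms on the right are then equal and cancel. *)
have YE i N : E (h N i) =
    h (maxn i.+1 (i + N) - minn i.+1 (i + N))%N (minn i.+1 (i + N)) + h N.+1 i.
  case: N => [|N].
    rewrite addn0 (maxn_idPl _) // (minn_idPr _) // subSnn linear0.
    by rewrite addvv_char2.
  have -> : (maxn i.+1 (i + N.+1) - minn i.+1 (i + N.+1))%N = N by lia.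
  have -> : minn i.+1 (i + N.+1) = i.+1 by lia.
  by rewrite /h /= addrCA addvv_char2 ?addr0.
move=> i j; case/orP: (leq_total i j) => le.
  have := YE i (j - i)%N; rewrite subnKC // => {}YE.
  rewrite (maxn_idPr le) (minn_idPl le) YE; congr (_ + h _ _); lia.
have := YE j (i - j)%N; rewrite subnKC // => {}YE.
rewrite (maxn_idPl le) (minn_idPr le) YE addrC; congr (h _ _ + h _ _); lia.
Qed.

(** When the power is doubled, the cross term with both indices raised occurs twice and cancels. *)
Lemma ladder_iter_pow2 Y : ladder E Y -> forall a i j,
  iter (2 ^ a) E (Y i j) = Y (i + 2 ^ a)%N j + Y i (j + 2 ^ a)%N.
Proof.
case=> Y0 YC YE; elim=> [|a IH] i j; first by rewrite /= YE !addn1.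
rewrite expnS mul2n -addnn iterD IH linearD /= !IH !addnA.
by rewrite addrA -[X in X + _]addrA (addvv_char2 charK) addr0.
Qed.

(** In the inductive step one of the two terms of [ladder_iter_pow2] is diagonal, hence zero. *)
Lemma ladder_iter_pred_pow2 Y : ladder E Y -> forall a i,
  iter (2 ^ a).-1 E (Y i i.+1) = Y i (i + 2 ^ a)%N.
Proof.
move=> lY; have [Y0 _ _] := lY; elim=> [|a IH] i; first by rewrite addn1.
have -> : (2 ^ a.+1).-1 = (2 ^ a + (2 ^ a).-1)%N.
  by rewrite expnS; have := expn_gt0 2 a; lia.
by rewrite iterD IH ladder_iter_pow2 // Y0 add0r -addnA addnn expnS mul2n.
Qed.

End Ladder.

(** * Spanning vectors of the exterior square of a row space, and linear maps out of it *)

Section ExteriorSquareOfRows.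
Variables (K : fieldType) (n : nat).

(* Zero when [i >= n]. *)
Definition rowX i : 'rV[K]_n := \row_j (j == i :> nat)%:R.

Lemma rowX_out i : (n <= i)%N -> rowX i = 0.
Proof.
by move=> le; apply/rowP => j; rewrite !mxE ltn_eqF // (leq_trans (ltn_ord j)).
Qed.

Lemma row_sum_rowX (v : 'rV[K]_n) : v = \sum_(i < n) v 0 i *: rowX i.
Proof.
apply/rowP => j; rewrite summxE (bigD1 j) //= !mxE eqxx mulr1 big1 ?addr0 //.
by move=> i; rewrite -val_eqE eq_sym /= !mxE => /negPf ->; rewrite mulr0.
Qed.

Lemma rowX_jordan i : rowX i *m jordan0 K n = rowX i.+1.
Proof.
apply/rowP => j; rewrite !mxE.
have [lt|ge] := ltnP i n; last first.
  rewrite big1 => [|k _]; last first.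
    by rewrite !mxE ltn_eqF ?mul0r // (leq_trans (ltn_ord k)).
  by rewrite ltn_eqF // (leq_trans (ltn_ord j)) // leqW.
rewrite (bigD1 (Ordinal lt)) //= !mxE eqxx mul1r big1 ?addr0 => [|k].
  by rewrite eq_sym.
by rewrite -val_eqE /= !mxE => /negPf ->; rewrite mul0r.
Qed.

Definition wedgeX i j : ext2 'rV[K]_n := wedge (rowX i) (rowX j).

Lemma wedge0l (V : lmodType K) (v : V) : wedge 0 v = 0.
Proof. by have := wedgeBl 0 0 v; rewrite !subrr. Qed.

Lemma wedge0r (V : lmodType K) (v : V) : wedge v 0 = 0.
Proof. by have := wedgeBr v 0 0; rewrite !subrr. Qed.

Lemma wedgeX_outl i j : (n <= i)%N -> wedgeX i j = 0.
Proof. by move=> le; rewrite /wedgeX rowX_out // wedge0l. Qed.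

Lemma wedgeX_outr i j : (n <= j)%N -> wedgeX i j = 0.
Proof. by move=> le; rewrite /wedgeX (rowX_out le) wedge0r. Qed.

Lemma ext2_row_ind (P : ext2 'rV[K]_n -> Prop) :
    P 0 -> (forall a x y, P x -> P y -> P (a *: x + y)) ->
    (forall i j, (i < n)%N -> (j < n)%N -> P (wedgeX i j)) ->
  forall x, P x.
Proof.
move=> P0 PL Pw; elim/ext2_ind => // a v w x Px; apply: (PL) => //.
rewrite (row_sum_rowX v); elim/big_ind: _ => [|u1 u2 P1 P2|i _].
- by rewrite wedge0l.
- by rewrite wedgeDl -[X in P (X + _)]scale1r; apply: PL.
rewrite -[_ *: _]addr0 wedge_linearl wedge0l; apply: (PL) => //.
rewrite (row_sum_rowX w); elim/big_ind: _ => [|u1 u2 P1 P2|j _].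
- by rewrite wedge0r.
- by rewrite wedgeDr -[X in P (X + _)]scale1r; apply: PL.
by rewrite -[_ *: _]addr0 wedge_linearr wedge0r; apply: (PL) => //; apply: Pw.
Qed.

Section LiftRows.
Variables (U : lmodType K) (T : 'I_n -> 'I_n -> U).

Definition row_form (v w : 'rV[K]_n) : U :=
  \sum_i \sum_j (v 0 i * w 0 j) *: T i j.

Lemma row_form_alternating (charK : 2%N \in [pchar K]) :
  (forall i, T i i = 0) -> (forall i j, T i j = T j i) ->
  alternating_bilinear row_form.
Proof.
move=> T0 TC; rewrite /row_form; split=> [w a u v|v a u w|v].
- rewrite scaler_sumr -big_split; apply: eq_bigr => i _ /=.
  rewrite scaler_sumr -big_split; apply: eq_bigr => j _ /=.
  by rewrite !mxE mulrDl scalerDl scalerA mulrA.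
- rewrite scaler_sumr -big_split; apply: eq_bigr => i _ /=.
  rewrite scaler_sumr -big_split; apply: eq_bigr => j _ /=.
  by rewrite !mxE mulrDr scalerDl scalerA mulrCA.
(* The sum is split into [i < j], [j < i] and the diagonal; exchanging the indices identifies the
   first two parts, which cancel in characteristic 2. *)
rewrite pair_big /=.
rewrite (bigID (fun k : 'I_n * 'I_n => (k.1 < k.2)%N)) /=.
rewrite [X in _ + X](bigID (fun k : 'I_n * 'I_n => (k.2 < k.1)%N)) /=.
rewrite [X in _ + (_ + X)]big1 ?addr0; last first.
  move=> [i j] /= /andP[]; rewrite -!leqNgt => le1 le2.
  have -> : i = j by apply/val_inj/anti_leq; rewrite le1 le2.
  by rewrite T0 scaler0.
rewrite [X in _ + X](reindex_inj (h := fun k : 'I_n * 'I_n => (k.2, k.1))) /=;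
  last by move=> [i j] [k l] [-> ->].
rewrite [X in _ + X](_ : _ = \sum_(k : 'I_n * 'I_n | (k.1 < k.2)%N)
    (v 0 k.1 * v 0 k.2) *: T k.1 k.2).
  exact: addvv_char2.
apply: eq_big => [k|k _]; last by rewrite TC mulrC.
by rewrite andbC; case: ltngtP.
Qed.

Lemma row_formX (i j : 'I_n) : row_form (rowX i) (rowX j) = T i j.
Proof.
rewrite /row_form (bigD1 i) //= [X in _ + X]big1 => [|k]; last first.
  rewrite -val_eqE /= => /negPf ne; apply: big1 => l _.
  by rewrite !mxE ne mul0r scale0r.
rewrite addr0 (bigD1 j) //= big1 => [|l]; last first.
  by rewrite -val_eqE /= => /negPf ne; rewrite !mxE ne mulr0 scale0r.
by rewrite !mxE !eqxx mulr1 scale1r addr0.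
Qed.

End LiftRows.

(** Stands in for the linear independence of the [X_i /\ X_j] with [i < j]. *)
Lemma ext2_row_lift (charK : 2%N \in [pchar K]) (U : lmodType K)
    (T : nat -> nat -> U) :
  (forall i, T i i = 0) -> (forall i j, T i j = T j i) ->
  exists f : {linear ext2 'rV[K]_n -> U},
    forall i j, (i < n)%N -> (j < n)%N -> f (wedgeX i j) = T i j.
Proof.
move=> T0 TC; pose B := row_form (fun i j : 'I_n => T i j).
have altB : alternating_bilinear B by apply: row_form_alternating.
pose F : {linear ext2 'rV[K]_n -> U} :=
  HB.pack (ext_lift B) (GRing.isLinear.Build K _ U _ _ (ext_lift_linear altB)).
exists F => i j lti ltj; rewrite /= ext_lift_wedge //.
exact: (row_formX (fun i j : 'I_n => T i j) (Ordinal lti) (Ordinal ltj)).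
Qed.

End ExteriorSquareOfRows.

(** * Coefficient functionals and their values along the iterates of [E] *)

Section PairCoefficient.
Variables (K : fieldType) (n : nat) (A B : nat).

Lemma pair_coef_exists (charK : 2%N \in [pchar K]) : (A < n)%N -> (B < n)%N ->
  exists lam : {linear ext2 'rV[K]_n -> K^o}, forall i j,
    lam (wedgeX K n i j)
    = ((i == A) && (j == B))%:R + ((i == B) && (j == A))%:R.
Proof.
move=> ltA ltB; pose T i j : K^o :=
  ((i == A) && (j == B))%:R + ((i == B) && (j == A))%:R.
have T0 i : T i i = 0 by rewrite /T (andbC (i == B)) addvv_char2.
have TC i j : T i j = T j i.
  by rewrite /T addrC (andbC (i == A)) (andbC (i == B)).
have [lam lamE] := ext2_row_lift n charK T0 TC.
exists lam => i j; rewrite -/(T i j).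
have [lti|gei] := ltnP i n; last first.
  rewrite wedgeX_outl // linear0 /T.
  have [-> ->] : (i == A) = false /\ (i == B) = false by split; lia.
  by rewrite addr0.
have [ltj|gej] := ltnP j n; last first.
  rewrite wedgeX_outr // linear0 /T (andbC (i == A)) (andbC (i == B)).
  have [-> ->] : (j == A) = false /\ (j == B) = false by split; lia.
  by rewrite addr0.
exact: lamE.
Qed.

Variables (E : {linear ext2 'rV[K]_n -> ext2 'rV[K]_n}).
Variable lam : {linear ext2 'rV[K]_n -> K^o}.
Hypothesis lY : ladder E (wedgeX K n).
Hypothesis lamE : forall i j, lam (wedgeX K n i j)
    = ((i == A) && (j == B))%:R + ((i == B) && (j == A))%:R.

(** [E] raises the sum of the indices by one. *)
Lemma pair_coef_degree N i j :
  (i + j + N)%N != (A + B)%N -> lam (iter N E (wedgeX K n i j)) = 0.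
Proof.
have [_ _ YE] := lY; elim: N i j => [|N IH] i j ne.
  have -> : iter 0 E (wedgeX K n i j) = wedgeX K n i j by [].
  rewrite lamE.
  by rewrite !(introF andP) ?addr0 // => -[/eqP ? /eqP ?]; move/eqP: ne; lia.
rewrite iterSr YE !linearD /= !IH ?addr0 //; apply: contra_neq ne; lia.
Qed.

(** [E] never lowers an index, so the second one stays above both [A] and [B]. *)
Lemma pair_coef_gt N i j :
  (A < B)%N -> (B < j)%N -> lam (iter N E (wedgeX K n i j)) = 0.
Proof.
have [_ _ YE] := lY => ltAB; elim: N i j => [|N IH] i j ltBj.
  have -> : iter 0 E (wedgeX K n i j) = wedgeX K n i j by [].
  rewrite lamE.
  by rewrite !(introF andP) ?addr0 // => -[/eqP ? /eqP ?]; lia.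
by rewrite iterSr YE !linearD /= !IH ?addr0 // leqW.
Qed.

(** Only the branch that always raises the first index contributes: once [B] is raised,
    [pair_coef_gt] applies. *)
Lemma pair_coef_top N i :
  (A < B)%N -> (i + N)%N = A -> lam (iter N E (wedgeX K n i B)) = 1.
Proof.
have [_ _ YE] := lY => ltAB; elim: N i => [|N IH] i eqA.
  have -> : iter 0 E (wedgeX K n i B) = wedgeX K n i B by [].
  by rewrite lamE -eqA addn0 !eqxx andbC gtn_eqF ?addr0 //; lia.
rewrite iterSr YE !linearD /= IH ?addSnnS // pair_coef_gt ?addr0 //.
Qed.

End PairCoefficient.

Lemma row_jordan (K : fieldType) n (c : nat -> K) :
  (\row_(i < n) c i) *m jordan0 K n
  = \row_(i < n) (if i : nat is i'.+1 then c i' else 0).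
Proof.
apply/rowP => j; rewrite !mxE; case: j => -[|j] lt /=.
  by rewrite big1 // => k _; rewrite !mxE mulr0.
rewrite (bigD1 (Ordinal (ltnW lt))) //= !mxE eqxx mulr1 big1 ?addr0 // => k.
by rewrite -val_eqE /= !mxE eqSS => /negPf ->; rewrite mulr0.
Qed.

(** * Splitting of the exterior square, where [n = p + d] and [m = p - d] *)

Section Splitting.
Variables (K : fieldType) (charK : 2%N \in [pchar K]).
Variables (a n m d : nat).
Local Notation p := (2 ^ a)%N.
Hypotheses (nE : n = (p + d)%N) (pE : p = (m + d)%N).
Variable E : {linear ext2 'rV[K]_n -> ext2 'rV[K]_n}.
Hypothesis lY : ladder E (wedgeX K n).
Local Notation Y := (wedgeX K n).

Section Quotient.
Variable E' : {linear ext2 'rV[K]_m -> ext2 'rV[K]_m}.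
Hypothesis lY' : ladder E' (wedgeX K m).

Lemma iterp_eq0 v : iter p E' v = 0.
Proof.
elim/ext2_row_ind: v => [|c x y Ex Ey|i j _ _]; first exact: linear0.
  by rewrite linearP /= Ex Ey scaler0 addr0.
rewrite (ladder_iter_pow2 charK) // wedgeX_outl ?wedgeX_outr ?addr0 //; lia.
Qed.

Lemma quotient_map_exists :
  exists s : {linear ext2 'rV[K]_n -> ext2 'rV[K]_m},
    [/\ forall v, s (E v) = E' (s v),
        forall i j, (i < m)%N -> (j < m)%N ->
          s (Y (i + d)%N (j + d)%N) = wedgeX K m i j
      & forall k, (k < d)%N -> s (Y k k.+1) = 0].
Proof.
pose b k := if (k < d)%N then 0 else wedgeX K m (k - d) (k - d).+1.
have [T lT Tb] := ladder_exists charK E' b.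
have [T0 TC TE] := lT.
have Td i j : T (i + d)%N (j + d)%N = wedgeX K m i j.
  apply: (ladder_eq charK (ladder_shift d lT) lY') => k.
  by rewrite addSn Tb /b ltnNge leq_addl addnK.
(* Needed for [s] to agree with [T] at all indices. As [E'] has zero [p]-th power, [T i j] equals
   [T (i + p) (j - p)] up to sign; both indices are at least [d], and shifting back by [d] gives a
   wedge whose first index is [i + m]. *)
have Tout i j : (n <= j)%N -> T i j = 0.
  move=> le; have -> : j = (j - p + p)%N by lia.
  have := ladder_iter_pow2 charK lT a i (j - p); rewrite iterp_eq0.
  have -> : (i + p)%N = (i + m + d)%N by lia.
  have eqj : (j - p)%N = (j - p - d + d)%N by lia.
  rewrite {1}eqj Td wedgeX_outl ?add0r //; lia.
have [s sE] := ext2_row_lift n charK T0 TC.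
have sT i j : s (Y i j) = T i j.
  have [lti|gei] := ltnP i n; last first.
    by rewrite wedgeX_outl // linear0 TC Tout.
  have [ltj|gej] := ltnP j n; last by rewrite wedgeX_outr // linear0 Tout.
  exact: sE.
exists s; split=> [v|i j _ _|k ltk].
- elim/ext2_row_ind: v => [|c x y Ex Ey|i j _ _]; first by rewrite !linear0.
    by rewrite !linearP /= Ex Ey.
  by have [_ _ ->] := lY; rewrite linearD /= !sT TE.
- by rewrite sT Td.
- by rewrite sT Tb /b ltk.
Qed.

End Quotient.

Variable Q : nat.
Hypothesis QE : Q = (2 ^ a.+1).-1.

Lemma Q_addE : Q = (p.-1 + p)%N.
Proof. by rewrite QE expnS; have := expn_gt0 2 a; lia. Qed.

Lemma p_gt0 : (0 < p)%N. Proof. by rewrite expn_gt0. Qed.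

Lemma iterQ_bottom i : iter Q E (Y i i.+1) = 0.
Proof.
rewrite QE (ladder_iter_pred_pow2 charK) // wedgeX_outr // nE expnS; lia.
Qed.

(** By [ladder_ind] it suffices to treat the generators [Y i i.+1], where an index moves to
    [i + 2p], beyond [n]. *)
Lemma iterQ_eq0 v : iter Q E v = 0.
Proof.
elim/ext2_row_ind: v => [|c x y Ex Ey|i j _ _]; first exact: linear0.
  by rewrite linearP /= Ex Ey scaler0 addr0.
apply: (ladder_ind charK (P := fun v => iter Q E v = 0) lY).
- exact: linear0.
- by move=> u v Eu Ev; rewrite linearD /= Eu Ev addr0.
- by move=> u Eu; rewrite -iterSr iterS Eu linear0.
- exact: iterQ_bottom.
Qed.

(** Parametrises the submodule [F] by [d] copies of the space of [W_Q]. *)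
Definition free_part (w : {ffun 'I_d -> 'rV[K]_Q}) : ext2 'rV[K]_n :=
  \sum_k \sum_i w k 0 i *: iter i E (Y k k.+1).

Lemma free_part_linear : linear free_part.
Proof.
move=> c v w; rewrite /free_part scaler_sumr -big_split; apply: eq_bigr => k _ /=.
rewrite scaler_sumr -big_split; apply: eq_bigr => i _ /=.
by rewrite !ffunE !mxE scalerDl scalerA.
Qed.

HB.instance Definition _ := GRing.isLinear.Build K
  {ffun 'I_d -> 'rV[K]_Q} (ext2 'rV[K]_n) _ free_part free_part_linear.

Definition in_free v := exists w, v = free_part w.

Lemma in_freeP c u v : in_free u -> in_free v -> in_free (c *: u + v).
Proof. by move=> [w ->] [z ->]; exists (c *: w + z); rewrite linearP. Qed.

Lemma in_free0 : in_free 0.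
Proof. by exists 0; rewrite linear0. Qed.

Lemma in_free_iter i k : (k < d)%N -> in_free (iter i E (Y k k.+1)).
Proof.
move=> ltk; have [lti|gei] := ltnP i Q; last first.
  rewrite -(subnK gei) iterD iterQ_eq0 linear0; exact: in_free0.
exists [ffun l : 'I_d => \row_(j < Q) ((l == k :> nat) && (j == i :> nat))%:R].
rewrite /free_part (bigD1 (Ordinal ltk)) //= (bigD1 (Ordinal lti)) //=.
rewrite ffunE mxE !eqxx scale1r big1 => [|j]; last first.
  by rewrite -val_eqE mxE /= => /negPf ->; rewrite scale0r.
rewrite addr0 big1 ?addr0 // => l.
rewrite -val_eqE /= => /negPf ne; apply: big1 => j _.
by rewrite ffunE mxE ne scale0r.
Qed.

Lemma in_freeE v : in_free v -> in_free (E v).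
Proof.
case=> w ->; rewrite linear_sum /=.
elim/big_ind: _ => [|u1 u2 ? ?|k _]; first exact: in_free0.
  by rewrite -[u1]scale1r; apply: in_freeP.
rewrite linear_sum /=.
elim/big_ind: _ => [|u1 u2 ? ?|i _]; first exact: in_free0.
  by rewrite -[u1]scale1r; apply: in_freeP.
rewrite linearZ /= -iterS -[_ *: _]addr0.
by apply: in_freeP in_free0; apply: in_free_iter.
Qed.

(** Checked on generators: those with [k < d] lie in [F], and for [k >= d] both raised indices reach
    [n]. *)
Lemma iterp_in_free i j : in_free (iter p E (Y i j)).
Proof.
apply: (ladder_ind charK (P := fun v => in_free (iter p E v)) lY).
- rewrite linear0; exact: in_free0.
- by move=> u v Fu Fv; rewrite linearD -[X in X + _]scale1r; apply: in_freeP.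
- by move=> u Fu; rewrite -iterSr iterS; apply: in_freeE.
move=> k; have [ltk|gek] := ltnP k d; first exact: in_free_iter.
rewrite (ladder_iter_pow2 charK lY) wedgeX_outl ?wedgeX_outr ?addr0; try lia.
exact: in_free0.
Qed.

(** The sums [t u + free_part w] are stable under [E] and contain all generators: when [E] pushes an
    index of [Y (i + d) (j + d)] up to [m + d = p], the result falls into [F]. *)
Lemma complement_map_exists :
  exists2 t : {linear ext2 'rV[K]_m -> ext2 'rV[K]_n},
    forall i j, (i < m)%N -> (j < m)%N ->
      t (wedgeX K m i j) = Y (i + d)%N (j + d)%N
    & forall v, exists u w, v = t u + free_part w.
Proof.
have [Y0 YC YE] := lY.
have [Z0 ZC _] := ladder_shift d lY.
have [t tE] := ext2_row_lift m charK Z0 ZC.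
exists t => //; pose G v := exists u w, v = t u + free_part w.
have G0 : G 0 by exists 0, 0; rewrite !linear0 addr0.
have GP c u v : G u -> G v -> G (c *: u + v).
  move=> [u1 [w1 ->]] [u2 [w2 ->]]; exists (c *: u1 + u2), (c *: w1 + w2).
  by rewrite !linearP /= scalerDr addrACA.
have GD u v : G u -> G v -> G (u + v).
  by move=> Gu Gv; rewrite -[u]scale1r; apply: GP.
have GF v : in_free v -> G v.
  by case=> w ->; exists 0, w; rewrite linear0 add0r.
have Gm i j : (m <= j)%N -> G (Y (i + d)%N (j + d)%N).
  move=> le; apply: GF.
  (* Since [i + d + p >= n], one term vanishes and [Y (i + d) (j + d)] is a [p]-th iterate. *)
  have := ladder_iter_pow2 charK lY a (i + d) (j - m).
  rewrite (@wedgeX_outl _ _ (i + d + p)) ?add0r; last by lia.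
  have -> : (j - m + p)%N = (j + d)%N by lia.
  by move=> <-; apply: iterp_in_free.
have Gd i j : G (Y (i + d)%N (j + d)%N).
  have [gei|lti] := leqP m i; first by rewrite YC; apply: Gm.
  have [gej|ltj] := leqP m j; first exact: Gm.
  by exists (wedgeX K m i j), 0; rewrite linear0 addr0 tE.
have GE v : G v -> G (E v).
  move=> [u [w ->]]; rewrite linearD; apply: (GD); last first.
    by apply/GF/in_freeE; exists w.
  elim/ext2_row_ind: u => [|c x y Gx Gy|i j lti ltj].
  - by rewrite !linear0.
  - by rewrite !linearP /=; apply: GP.
  - by rewrite tE // YE -!addSn; apply: GD; apply: Gd.
elim/ext2_row_ind => // i j _ _; apply: (ladder_ind charK (P := G) lY) => // k.
have [ltk|gek] := ltnP k d; first by apply/GF/(in_free_iter 0).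
by rewrite -(subnK gek) -addSn; apply: Gd.
Qed.

Lemma free_retraction_exists :
  exists r : {linear ext2 'rV[K]_n -> {ffun 'I_d -> 'rV[K]_Q}},
    (forall v k, r (E v) k = r v k *m jordan0 K Q) /\
    bijective (r \o free_part).
Proof.
have ex_lam (k : 'I_d) : exists lam : {linear ext2 'rV[K]_n -> K^o},
    forall i j, lam (Y i j) =
      ((i == k + p.-1)%N && (j == k + p)%N)%:R
      + ((i == k + p)%N && (j == k + p.-1)%N)%:R.
  have := ltn_ord k; have := p_gt0 => *; apply: pair_coef_exists => //; lia.
have [lam lamE] := choice ex_lam.
(* Comparing degrees gives [N = Q.-1 + 2 (k - l)], and [N < Q] then forces [l = k]. *)
have lamF (k l : 'I_d) N : (l <= k)%N ->
    lam k (iter N E (Y l l.+1)) = ((l == k) && (N == Q.-1))%:R.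
  move=> le; have pgt0 := p_gt0; have Qp := Q_addE.
  have [ltN|geN] := ltnP N Q; last first.
    rewrite -(subnK geN) iterD iterQ_eq0 !linear0 subnK //.
    rewrite (gtn_eqF (m := Q.-1)) ?andbF //; lia.
  have [eqd|ned] := eqVneq (l + l.+1 + N)%N (k + p.-1 + (k + p))%N; last first.
    rewrite (pair_coef_degree lY (lamE k)) // (introF andP) // => -[/eqP eql /eqP eqN].
    by move/eqP: ned; rewrite eql eqN; lia.
  have eql : l = k by apply: val_inj => /=; lia.
  have eqN : N = (p.-1 + p.-1)%N by rewrite eql in eqd; lia.
  have -> : (N == Q.-1) by apply/eqP; lia.
  (* The first [p.-1] applications lead to [Y k (k + p)], the others raise [k] to [k + p.-1]. *)
  rewrite eql eqxx eqN iterD (ladder_iter_pred_pow2 charK lY).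
  by apply: (pair_coef_top lY (lamE k)) => //; lia.
(* The [K[e]]-map into a Jordan block induced by a functional: coordinate [i] of [E v] is coordinate
   [i - 1] of [v], and coordinate [0] vanishes by [iterQ_eq0]. *)
pose r v : {ffun 'I_d -> 'rV[K]_Q} :=
  [ffun k => \row_i lam k (iter (Q - i.+1) E v)].
have r_lin : linear r.
  by move=> c u v; apply/ffunP => k; apply/rowP => i; rewrite !ffunE !mxE !linearP.
pose rl : {linear ext2 'rV[K]_n -> {ffun 'I_d -> 'rV[K]_Q}} :=
  HB.pack r (GRing.isLinear.Build K _ _ _ _ r_lin).
exists rl; split=> [v k|].
  rewrite /= /r !ffunE (row_jordan Q (fun i => lam k (iter (Q - i.+1) E v))).
  apply/rowP => -[[|i] lt]; rewrite !mxE /=.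
    by rewrite -iterSr subn1 prednK // iterQ_eq0 linear0.
  by rewrite -iterSr; congr (lam k (iter _ E v)); lia.
(* In finite dimension an injective endomorphism is bijective, so only the kernel is examined. *)
pose phi := linfun (rl \o free_part).
have phiE w : phi w = rl (free_part w) by rewrite lfunE.
have inj : lker phi == 0%VS.
  apply/eqP/vspaceP => w; rewrite memv0; apply/idP/eqP => [|->]; last exact: mem0v.
  rewrite memv_ker phiE => /eqP rw0.
  (* Triangularity: descending on [k], the terms with [l > k] vanish by induction, those with
     [l < k] by [lamF], and coordinate [i] of the rest is [w k 0 i]. *)
  suff wk N (k : 'I_d) : (d - k <= N)%N -> w k = 0.
    by apply/ffunP => k; rewrite ffunE; apply: (wk d); apply: leq_subr.
  elim: N k => [|N IH] k le; first by have := ltn_ord k; lia.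
  have w0 (l : 'I_d) : (k < l)%N -> w l = 0.
    by move=> lt; apply: IH; have := ltn_ord l; lia.
  apply/rowP => i; move/ffunP/(_ k)/rowP/(_ i): rw0.
  rewrite /= /r /free_part !ffunE !mxE => rw0.
  rewrite -[RHS]rw0 !linear_sum (bigD1 k) //= [X in _ + X]big1 => [|l nel].
    rewrite addr0 !linear_sum (bigD1 i) //= big1 => [|j nej].
      rewrite addr0 !linearZ /= -iterD lamF // eqxx.
      have -> : (Q - i.+1 + i == Q.-1)%N by apply/eqP; have := ltn_ord i; lia.
      by rewrite [_ *: _]mulr1.
    rewrite !linearZ /= -iterD lamF // eqxx.
    suff -> : (Q - i.+1 + j == Q.-1)%N = false by rewrite scaler0.
    apply: contra_neqF nej => /eqP eqQ; apply: val_inj => /=.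
    by have := ltn_ord i; lia.
  have [ltl|ltl|eql] := ltngtP l k; last by rewrite (val_inj eql) eqxx in nel.
    rewrite !linear_sum big1 //= => j _.
    by rewrite !linearZ /= -iterD lamF ?(ltnW ltl) // (negPf nel) scaler0.
  by rewrite !linear_sum big1 //= => j _; rewrite w0 // mxE scale0r !linear0.
exists (phi^-1)%VF => w; first by rewrite -[LHS]/(phi^-1%VF (rl _)) -phiE lker0_lfunK.
by rewrite -[LHS]/(rl (free_part _)) -phiE lker0_lfunVK.
Qed.

Lemma splitting_exists (E' : {linear ext2 'rV[K]_m -> ext2 'rV[K]_m}) :
  ladder E' (wedgeX K m) ->
  exists (s : {linear ext2 'rV[K]_n -> ext2 'rV[K]_m})
         (r : {linear ext2 'rV[K]_n -> {ffun 'I_d -> 'rV[K]_Q}}),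
    [/\ forall v, s (E v) = E' (s v),
        forall v k, r (E v) k = r v k *m jordan0 K Q
      & bijective (fun v => (s v, r v))].
Proof.
move=> lY'; have [s [sE sX sF]] := quotient_map_exists lY'.
have [t tX tG] := complement_map_exists.
have [r [rE [h rK hK]]] := free_retraction_exists.
exists s, r; split=> //.
have st u : s (t u) = u.
  elim/ext2_row_ind: u => [|c x y Ex Ey|i j lti ltj]; first by rewrite !linear0.
    by rewrite !linearP /= Ex Ey.
  by rewrite tX // sX.
have s_iter i v : s (iter i E v) = iter i E' (s v).
  by elim: i => [|i IH] //; rewrite !iterS sE IH.
have sF0 w : s (free_part w) = 0.
  rewrite /free_part linear_sum big1 // => k _; rewrite linear_sum big1 // => i _.
  by rewrite linearZ /= s_iter sF // linear0 scaler0.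
(* [t] realises the first component; the second is then corrected inside [F], which [s] kills. *)
exists (fun z => t z.1 + free_part (h (z.2 - r (t z.1)))) => [v|[u w]] /=.
  have [u [w ->]] := tG v.
  have -> : s (t u + free_part w) = u by rewrite linearD /= st sF0 addr0.
  rewrite linearD /= addrAC subrr add0r.
  by have /= -> := rK w.
have /= rF z := hK z.
by rewrite !linearD /= st sF0 addr0 rF addrC subrK.
Qed.

End Splitting.

(** * Reduction of the Lie algebra action to its generator *)

Section ActionOfGenerator.
Variables (K : fieldType) (charK : 2%N \in [pchar K]) (alpha : nat).
Local Notation L := (wq charK alpha).
Local Notation e := (wq_e charK alpha).

Lemma act_iter_pmap (M : rmod L) i (x : L) (v : M) :
  act (iter i (@Defs.pmap K L) x) v = iter (2 ^ i) (act x) v.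
Proof.
elim: i v => [//|i IH] v.
by rewrite iterS act_pmap !IH -iterD addnn expnS mul2n.
Qed.

(** The iterated 2-maps of [e] form a basis, and restrictedness makes them act as powers of [e]. *)
Lemma act_sum_iter (M : rmod L) (x : L) (v : M) :
  act x v = \sum_(i < alpha) (x : 'rV[K]_alpha) 0 i *: iter (2 ^ i) (act e) v.
Proof.
have xE : x = \sum_(i < alpha) (x : 'rV[K]_alpha) 0 i *: iter i (@Defs.pmap K L) e.
  rewrite {1}(row_sum_rowX (x : 'rV[K]_alpha)); apply: eq_bigr => i _.
  by rewrite iter_pmap_wq_e.
pose g : {linear L -> M} :=
  HB.pack (fun x => act x v) (GRing.isLinear.Build K _ _ _ _ (act_linearl v)).
rewrite -[LHS]/(g _) {1}xE linear_sum; apply: eq_bigr => i _.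
by rewrite linearZ /= act_iter_pmap.
Qed.

Lemma act_generator (M N : rmod L) (f : {linear M -> N}) :
  (forall v, f (act e v) = act e (f v)) ->
  forall x v, f (act x v) = act x (f v).
Proof.
move=> fe x v; rewrite !act_sum_iter linear_sum; apply: eq_bigr => i _.
rewrite linearZ /=; congr (_ *: _).
by elim: (2 ^ i)%N => //= k <-; rewrite fe.
Qed.

Hypothesis alpha_gt0 : (0 < alpha)%N.

Lemma act_W_generator i (hi : (i <= 2 ^ alpha)%N) (v : W charK hi) :
  act e v = v *m jordan0 K i.
Proof. by rewrite -(W_mx_e charK i alpha_gt0). Qed.

Lemma wedgeC (V : lmodType K) (v w : V) : wedge v w = wedge w v.
Proof.
have := wedgevv (v + w); rewrite wedgeDl !wedgeDr !wedgevv add0r addr0.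
by move/(congr1 (+%R^~ (wedge w v))); rewrite -addrA addvv_char2 // addr0 add0r.
Qed.

Lemma wedgeX_ladder i (hi : (i <= 2 ^ alpha)%N) :
  ladder (@act K L (ext2_mod (W charK hi)) e) (wedgeX K i).
Proof.
split=> [j|j k|j k]; [exact: wedgevv | exact: wedgeC |].
rewrite [LHS](ext2_act_wedge (M := W charK hi)) !act_W_generator.
by rewrite !rowX_jordan.
Qed.

End ActionOfGenerator.

Local Close Scope ring_scope.

Theorem theorem1p8 (K : fieldType) (charK : 2%N \in [pchar K]%R)
    (alpha n : nat) (alpha_gt0 : 0 < alpha)
    (gt_n : (2 ^ alpha) %/ 2 < n) (le_n : n <= 2 ^ alpha) :
  rmod_iso (ext2_mod (W charK le_n))
    (dsum (ext2_mod (W charK (leq_subr n (2 ^ alpha))))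
          (copies (n - (2 ^ alpha) %/ 2) (W charK (leq_subr 1 (2 ^ alpha))))).
Proof.
(* The splitting is applied with [a = alpha.-1], so that [p] is half of [2 ^ alpha]. *)
have qE : 2 ^ alpha = 2 * 2 ^ alpha.-1 by rewrite -expnS prednK.
set d := n - _; set m := 2 ^ alpha - n; set Q := 2 ^ alpha - 1.
have nE : n = 2 ^ alpha.-1 + d by rewrite /d; lia.
have pE : 2 ^ alpha.-1 = m + d by rewrite /m /d; lia.
have QE : Q = (2 ^ alpha.-1.+1).-1 by rewrite prednK // /Q subn1.
set M := ext2_mod _; set M' := ext2_mod _; set C := copies _ _.
pose e := wq_e charK alpha.
pose E : {linear ext2 'rV[K]_n -> ext2 'rV[K]_n} := (act e : {linear M -> M}).
pose E' : {linear ext2 'rV[K]_m -> ext2 'rV[K]_m} :=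
  (act e : {linear M' -> M'}).
have lY : ladder E (wedgeX K n) by apply: wedgeX_ladder.
have lY' : ladder E' (wedgeX K m) by apply: wedgeX_ladder.
have [s [r [sE rE bij_sr]]] := splitting_exists charK nE pE lY QE lY'.
pose f (v : M) : dsum M' C := (s v, r v).
have f_lin : linear f by move=> c u v; rewrite /f !linearP.
pose fl : {linear M -> dsum M' C} :=
  HB.pack f (GRing.isLinear.Build K _ _ _ _ f_lin).
exists fl; split; first exact: bij_sr.
apply: act_generator => v; congr (_, _); first exact: sE.
by apply/ffunP => k; rewrite ffunE act_W_generator //; apply: rE.
Qed.
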